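(* Let $V$ be a finite non-empty set, $K$ a non-degenerate sub-stochastic matrix on $V$, $\lambda\in(0,\infty)$, and $\nu$ an admissible probability distribution on $V$. Then the relaxation time of the $\mathrm{ARW}(K,\lambda,\nu)$ chain is exactly $$t_{\mathrm{rel}}\;=\;\Big(\min_{x\in V}p(x)\Big)^{-1},\qquad\text{where } p(x):=\mathbf P_\nu(\tau_x<\tau_\dagger).$$
   Context: $V$ is a finite set of sites. A sub-stochastic matrix on $V$ is a function $K\colon V^2\to[0,1]$ with $\sum_{y\in V}K(x,y)\le 1$ for all $x$; it is non-degenerate if no principal sub-matrix of $K$ is stochastic. A $K$-walk is the killed random walk which, when alive at $x$, jumps to $y\in V$ at rate $K(x,y)$ and is killed at rate $1-\sum_{y}K(x,y)$. $\mathbf P_\nu$ is the law of a $K$-walk with initial distribution $\nu$; $\tau_\dagger$ is its life-time (killing time) and $\tau_x$ its hitting time of $x$ (equal to $0$ if it starts at $x$). The distribution $\nu$ is admissible if its support intersects every connected component of $K$, so that every site has a positive probability of being visited by a $K$-walk started from $\nu$, i.e. $p(x)>0$ for all $x\in V$. ARW dynamics: a configuration is $\eta\in\{0,\mathrm s,1,2,\ldots\}^V$; the site $x$ is empty if $\eta(x)=0$, holds one sleeping particle if $\eta(x)=\mathrm s$, and holds $k\ge1$ active particles if $\eta(x)=k$. In continuous time, active particles perform independent $K$-walks (a killed particle is removed), but fall asleep at rate $\lambda$ when alone on a site; sleeping particles do not move, but become active upon contact with another particle. Configurations in $\{0,\mathrm s\}^V$ are stable, and from any configuration with finitely many particles the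 process is almost surely absorbed in a stable configuration (stabilization). The $\mathrm{ARW}(K,\lambda,\nu)$ chain is the discrete-time Markov chain on $\mathcal X=\{0,\mathrm s\}^V$ which at each step adds one active particle to the current state at an independent $\nu$-distributed random site and then runs the ARW dynamics until a stable configuration is obtained; the latter is the new state. Its transition matrix $P$ is irreducible and aperiodic, with unique invariant distribution $\pi$. Relaxation time: $\rho:=\max\{|z|\colon z\in\mathbb C\setminus\{1\}\text{ is an eigenvalue of }P\}$ and $t_{\mathrm{rel}}:=\frac1{1-\rho}$. *)

(* Defs.v *)
From HB Require Import structures.
From mathcomp Require Import all_boot all_order all_algebra.
From mathcomp Require Import all_classical all_reals all_analysis.
From mathcomp Require Import complex.

Set Implicit Arguments.
Unset Strict Implicit.
Unset Printing Implicit Defensive.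

Import Order.TTheory GRing.Theory Num.Theory.
Import numFieldNormedType.Exports.

Local Open Scope classical_set_scope.
Local Open Scope ring_scope.

Section ContinuousTimeChains.
Variables (R : realType) (T : Type).

(* [markov_semigroup L t f a] is the expectation of f(X_t) for the
   continuous-time Markov chain X with generator L started at a, that is
   (e^{tL} f)(a), with e^{tL} given by its power series.  The series converges
   for the generators below: from each state only finitely many states are
   reachable, so L acts there as a finite matrix. *)
Definition markov_semigroup (L : (T -> R) -> (T -> R)) (t : R) (f : T -> R)
    (a : T) : R :=
  limn (series (fun n => t ^+ n / n`!%:R * iter n L f a)).

(* For an absorbing state b, the events {X_t = b} increase with t, to the event
   that the chain started at a is eventually absorbed at b. *)
Definition absorption_probability (L : (T -> R) -> (T -> R)) (a b : T) : R :=
  lim (markov_semigroup L t (\1_[set b]) a @[t --> +oo]).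

End ContinuousTimeChains.

Section KilledWalk.
Variables (R : realType) (V : finType).
Implicit Types (K : V -> V -> R) (nu : V -> R).

Definition substochastic K : Prop :=
  (forall x y, 0 <= K x y <= 1) /\ (forall x, \sum_(y : V) K x y <= 1).

Definition non_degenerate K : Prop :=
  forall A : {set V}, A != finset.set0 ->
    ~ (forall x, x \in A -> \sum_(y in A) K x y = 1).

Definition killing_rate K (x : V) : R := 1 - \sum_(y : V) K x y.

(* The K-walk stopped on hitting x; the cemetery is None. *)
Definition stopped_walk_generator K (x : V) (f : option V -> R)
    (a : option V) : R :=
  if a is Some y then
    if y == x then 0
    else \sum_(z : V) K y z * (f (Some z) - f (Some y))
         + killing_rate K y * (f None - f (Some y))
  else 0.

(* P_nu(tau_x < tau_dagger): as a killed walk never visits x afterwards, this is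
   the probability that the walk stopped on hitting x ends at x. *)
Definition hitting_probability K nu (x : V) : R :=
  \sum_(y : V) nu y *
    absorption_probability (stopped_walk_generator K x) (Some y) (Some x).

Definition prob_distribution nu : Prop :=
  (forall x, 0 <= nu x) /\ \sum_(x : V) nu x = 1.

(* K need not be symmetric, so the requirement that the support of nu meet the
   components of K is read as: every site can be reached from the support along
   jumps of positive rate. *)
Definition admissible K nu : Prop :=
  forall x, exists2 y, 0 < nu y & connect [rel u v | 0 < K u v] y x.

End KilledWalk.

Section ActivatedRandomWalk.
Variables (R : realType) (V : finType).
Implicit Types (K : V -> V -> R) (nu : V -> R) (lambda : R).

(* None is the state s (one sleeping particle), Some 0 an empty site, and
   Some k with k >= 1 a site holding k active particles. *)
Definition config := {ffun V -> option nat}.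
Implicit Types (eta : config).

Definition set_site eta (x : V) (s : option nat) : config :=
  [ffun y => if y == x then s else eta y].

Definition active_particles eta (x : V) : nat := odflt 0%N (eta x).

(* The added particle is active and wakes up a sleeping particle at x. *)
Definition add_particle eta (x : V) : config :=
  set_site eta x (Some (if eta x is Some k then k.+1 else 2)).

Definition remove_particle eta (x : V) : config :=
  set_site eta x (Some (active_particles eta x).-1).

Definition fall_asleep eta (x : V) : config := set_site eta x None.

Definition arw_generator K lambda (f : config -> R) eta : R :=
  \sum_(x : V) (active_particles eta x)%:R *
    (\sum_(y : V) K x y * (f (add_particle (remove_particle eta x) y) - f eta)
     + killing_rate K x * (f (remove_particle eta x) - f eta))
  + \sum_(x : V | eta x == Some 1%N) lambda * (f (fall_asleep eta x) - f eta).

(* A stable configuration, in {0,s}^V, is encoded by its set of occupied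
   sites. *)
Definition stable_config (A : {set V}) : config :=
  [ffun x => if x \in A then None else Some 0%N].

Definition stabilization_probability K lambda eta (B : {set V}) : R :=
  absorption_probability (arw_generator K lambda) eta (stable_config B).

Definition arw_transition K lambda nu (A B : {set V}) : R :=
  \sum_(x : V) nu x *
    stabilization_probability K lambda (add_particle (stable_config A) x) B.

Definition arw_matrix K lambda nu : 'M[R]_#|{set V}| :=
  \matrix_(i, j) arw_transition K lambda nu (enum_val i) (enum_val j).

End ActivatedRandomWalk.

Section RelaxationTime.
Variables (R : realType) (n : nat).

Definition nontrivial_eigenvalue_moduli (P : 'M[R]_n) : set R :=
  [set r | exists z : R[i],
     [/\ eigenvalue (map_mx (real_complex R) P) z, z != 1
       & `|z| = real_complex R r]].

(* rho is required to be a genuine maximum, so that t is the relaxation time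
   and the latter is well defined. *)
Definition is_relaxation_time (P : 'M[R]_n) (t : R) : Prop :=
  exists rho : R,
    [/\ nontrivial_eigenvalue_moduli P rho,
        ubound (nontrivial_eigenvalue_moduli P) rho
      & t = 1 / (1 - rho)].

End RelaxationTime.

(* Main.v *)
(* The spectrum of the chain is controlled by an internal aggregation process.
   By the abelian property, a function of the stabilized state is harmonic under
   toppling at each single active site.  Let every site of c in {0,s,1}^V hold
   at most one particle, with set G of active sites, and add a particle to c: it
   can be moved until it leaves G or is killed, so that either c is restored or
   some site outside G becomes active.  This dynamics is triangular for the
   number of active sites.  Hence a right eigenvector of P for z, extended to
   all configurations, gives z = q(c) at a maximal c where it does not vanish,
   where q(c) is the probability that the added particle is killed inside G:
   q(c) = 1 if G = V, and q(c) <= 1 - p(x) if x is not in G.  Conversely, if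
   mu(G) is the law of the stabilization of one active particle at each site of
   G, then mu(V \ {x}) P = (1 - p(x)) mu(V \ {x}) + p(x) mu(V) and
   mu(V) P = mu(V), so that mu(V \ {x}) - mu(V) is a left eigenvector for
   1 - p(x).  It is not zero, since only mu(V) charges the fully occupied
   state. *)

Require Import Defs.
From HB Require Import structures.
From mathcomp Require Import all_boot all_order all_algebra.
From mathcomp Require Import all_classical all_reals all_analysis.
From mathcomp Require Import complex.
From mathcomp Require Import ring lra.

Set Implicit Arguments.
Unset Strict Implicit.
Unset Printing Implicit Defensive.
Import Order.TTheory GRing.Theory Num.Theory.
Import numFieldNormedType.Exports.
Local Open Scope classical_set_scope.
Local Open Scope ring_scope.

(** * Preliminaries on finite sums, eigenvectors and complex linear combinations *)

Lemma sum_enum_val (M : nmodType) (T : finType) (F : T -> M) :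
  \sum_(i < #|T|) F (enum_val i) = \sum_x F x.
Proof. by rewrite -big_enum_val; apply: eq_bigl. Qed.

(** [eigenvalue] refers to row vectors; [A - a] is singular exactly when its transpose is, which
    supplies a column vector. *)
Lemma right_eigenvector (F : fieldType) n (A : 'M[F]_n) a :
  eigenvalue A a -> exists2 v : 'cV_n, A *m v = a *: v & v != 0.
Proof.
have unit (B : 'M[F]_n) : eigenvalue B a = (B - a%:M \notin unitmx).
  by rewrite /eigenvalue /eigenspace kermx_eq0 row_free_unit.
rewrite unit -unitmx_tr linearB /= tr_scalar_mx -unit.
move=> /eigenvalueP[v vE v0]; exists v^T; last by rewrite trmx_eq0.
by rewrite -[A]trmxK -trmx_mul vE linearZ.
Qed.

Lemma complex_lincomb (R : realType) (I : finType) (a : I -> R)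
    (v : I -> R[i]) :
  \sum_i (a i)%:C%C * v i =
  ((\sum_i a i * complex.Re (v i)) +i* (\sum_i a i * complex.Im (v i)))%C.
Proof.
elim/big_rec3: _ => // i x y z _ ->.
by case: (v i) => b c /=; congr (_ +i* _)%C; ring.
Qed.

(** * Cauchy products of series and powers of a shifted operator *)

Section Semigroups.
Context {R : realType}.

Lemma cauchy_product_partial_sums (a b : R^nat) (N : nat) :
  series (fun n => \sum_(k < n.+1) a k * b (n - k)%N) N =
  \sum_(k < N) a k * series b (N - k)%N.
Proof.
elim: N => [|N IH]; first by rewrite big_ord0 /series /= big_geq.
rewrite seriesSr IH [in RHS]big_ord_recr /= subSnn.
rewrite [X in _ + X]big_ord_recr /= addrA subnn.
have -> : series b 1 = b 0%N by rewrite /series /= big_nat1.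
congr (_ + _); rewrite -big_split /=; apply: eq_bigr => k _.
by rewrite subSn ?seriesSr ?mulrDr // ltnW.
Qed.

(** For the absolute values, the triangle of size [N] lies in the square of size [N], itself in the
    triangle of size [2N], so triangles and squares have the same limit. The signed discrepancy
    between square and triangle is at most the absolute one, which therefore tends to 0. *)
Lemma cvg_cauchy_product (a b : R^nat) :
  cvgn [normed series a] -> cvgn [normed series b] ->
  series (fun n => \sum_(k < n.+1) a k * b (n - k)%N) @ \oo -->
    limn (series a) * limn (series b).
Proof.
move=> ca cb.
set c := fun n => _.
pose a' n : R := `|a n|; pose b' n : R := `|b n|.
pose c' n : R := \sum_(k < n.+1) a' k * b' (n - k)%N.
have a'0 n : 0 <= a' n by exact: normr_ge0.
have b'0 n : 0 <= b' n by exact: normr_ge0.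
have ndb : nondecreasing_seq (series b').
  by apply/nondecreasing_seqP => n; rewrite seriesSr lerDl.
have nda : nondecreasing_seq (series a').
  by apply/nondecreasing_seqP => n; rewrite seriesSr lerDl.
have ndc : nondecreasing_seq (series c').
  apply/nondecreasing_seqP => n; rewrite seriesSr lerDl sumr_ge0// => k _.
  by rewrite mulr_ge0.
have b'S n : 0 <= series b' n by rewrite sumr_ge0.
have a'S n : 0 <= series a' n by rewrite sumr_ge0.
have leAB N : series c' N <= series a' N * series b' N.
  rewrite cauchy_product_partial_sums /series /= big_mkord mulr_suml ler_sum//.
  by move=> k _; rewrite ler_wpM2l// ndb// leq_subr.
have geAB N : series a' N * series b' N <= series c' (N + N)%N.
  rewrite cauchy_product_partial_sums big_split_ord /=.
  rewrite -[leLHS]addr0 lerD//; last first.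
    by rewrite sumr_ge0// => k _; rewrite mulr_ge0.
  rewrite {1}/series /= big_mkord mulr_suml ler_sum// => k _.
  by rewrite ler_wpM2l// ndb// -addnBA ?leq_addr// ltnW.
have cA : series a' @ \oo --> limn (series a') by [].
have cB : series b' @ \oo --> limn (series b') by [].
have cAB : series a' N * series b' N @[N --> \oo] -->
    limn (series a') * limn (series b') by exact: cvgM cA cB.
have cc' : cvgn (series c').
  apply: nondecreasing_is_cvgn => //.
  exists (limn (series a') * limn (series b')) => _ [n _ <-].
  apply: le_trans (leAB n) _.
  by apply: ler_pM => //; apply: nondecreasing_cvgn_le.
have cC : series c' @ \oo --> limn (series c') by [].
have limc' : limn (series c') = limn (series a') * limn (series b').
  apply/eqP; rewrite eq_le; apply/andP; split.
    by apply: (ler_cvg_to cC cAB); apply: nearW => n; exact: leAB.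
  apply: (ler_cvg_to cAB (cvg_cst (limn (series c')))).
  apply: nearW => n; apply: le_trans (geAB n) _.
  exact: nondecreasing_cvgn_le.
have gap0 : series a' n * series b' n - series c' n @[n --> \oo] --> 0.
  by rewrite -(subrr (limn (series c'))) {1}limc'; exact: cvgB cAB cC.
have gap N : `|series a N * series b N - series c N| <=
    series a' N * series b' N - series c' N.
  have seriesE (u : R^nat) : series u N = \sum_(k < N) u k.
    by rewrite /series /= big_mkord.
  rewrite !cauchy_product_partial_sums (seriesE a) (seriesE a') !mulr_suml.
  rewrite -!sumrB (le_trans (ler_norm_sum _ _ _))// ler_sum// => k _.
  rewrite -!mulrBr normrM ler_wpM2l// !sub_series_geq ?leq_subr//.
  exact: ler_norm_sum.
have gapc : series a N * series b N - series c N @[N --> \oo] --> 0.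
  apply/norm_cvg0P/(squeeze_cvgr _ (cvg_cst 0) gap0).
  by apply: nearW => n; rewrite normr_ge0 gap.
have cab : series a N * series b N @[N --> \oo] -->
    limn (series a) * limn (series b).
  exact: cvgM (normed_cvg ca) (normed_cvg cb).
rewrite -[X in _ --> X]subr0.
rewrite (_ : series c = fun N =>
  series a N * series b N - (series a N * series b N - series c N)).
  exact: cvgB cab gapc.
by apply/funext => N; rewrite subKr.
Qed.

(** Binomial theorem for [L = (L + c) - c], where the scalar commutes with the linear operator. *)
Lemma iter_sub_scale (T : Type) (L : (T -> R) -> T -> R)
    (Llin : forall k f g, L (fun a => k * f a + g a) =
                          fun a => k * L f a + L g a)
    (c : R) (f : T -> R) (n : nat) (a : T) :
  iter n L f a = \sum_(k < n.+1)
    'C(n, k)%:R * (- c) ^+ (n - k) * iter k (fun g b => L g b + c * g b) f a.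
Proof.
have iterlin m k g h : iter m L (fun b => k * g b + h b) =
    fun b => k * iter m L g b + iter m L h b.
  by elim: m => //= m ->; rewrite Llin.
elim: n f => [|n IH] f; first by rewrite big_ord1 bin0 !mul1r.
set S := fun _ => _ in IH *.
rewrite iterSr.
have -> : L f = fun b => (- c) * f b + S f b.
  by apply/funext => b; rewrite /S; ring.
rewrite iterlin !IH [RHS]big_ord_recl /= bin0 subn0 mul1r.
under [X in _ = _ + X]eq_bigr => k _ do
  rewrite /bump /= add1n subSS binS natrD !mulrDl.
rewrite big_split /= addrA; congr (_ + _); last first.
  by apply: eq_bigr => k _; rewrite -iterSr.
rewrite big_ord_recl [X in _ = _ + X]big_ord_recr /= (bin_small (ltnSn n)).
rewrite mulr0n !mul0r addr0 bin0 subn0 mulrDr mul1r mulrA -exprS; congr (_ + _).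
rewrite mulr_sumr; apply: eq_bigr => k _.
by rewrite /bump /= add0n add1n -[in RHS]subSS subSn// exprS; ring.
Qed.

End Semigroups.

(** * Exponential decay of a semigroup under a Lyapunov function, and absorption probabilities *)

Section Absorption.
Context {R : realType} (T : Type) (L : (T -> R) -> T -> R).
Context (D : T -> Prop) (phi : T -> R) (c eps : R).
Hypothesis Llin : forall k f g,
  L (fun a => k * f a + g a) = fun a => k * L f a + L g a.
Hypothesis Lpos : forall f g : T -> R, (forall a, D a -> `|f a| <= g a) ->
  forall a, D a -> `|L f a + c * f a| <= L g a + c * g a.
Hypothesis eps_gt0 : 0 < eps.
Hypothesis eps_le : eps <= c.
Hypothesis phi_decay : forall a, D a -> L phi a <= - eps * phi a.

Let S := fun (f : T -> R) a => L f a + c * f a.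

Lemma generator0 : L (fun=> 0) = fun=> 0.
Proof.
have := Llin 1 (fun=> 0) (fun=> 0); rewrite mul1r addr0 => E.
apply/funext => a; move/(congr1 (fun h => h a)): E; rewrite mul1r => E.
by apply: (addrI (L (fun=> 0) a)); rewrite -E addr0.
Qed.

Lemma generatorZ (k : R) f : L (fun a => k * f a) = fun a => k * L f a.
Proof.
have -> : (fun a => k * f a) = (fun a => k * f a + 0).
  by apply/funext => a; rewrite addr0.
by rewrite (Llin k f (fun=> 0)) generator0; apply/funext => a; rewrite addr0.
Qed.

(** [Lpos] makes [L + c] a positive operator whose values on [D] depend only on values on [D]; by
    [phi_decay] each application multiplies the bound by at most [c - eps]. *)
Lemma iter_shifted_generator_le (g : T -> R) (C : R) (n : nat) (a : T) :
  0 <= C -> (forall a, D a -> `|g a| <= C * phi a) -> D a ->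
  `|iter n S g a| <= (c - eps) ^+ n * C * phi a.
Proof.
move=> C0 gC; elim: n a => [|n IH] a Da /=; first by rewrite mul1r gC.
have H := Lpos IH Da; apply: (le_trans H); rewrite generatorZ.
rewrite exprS -!mulrA [c * _]mulrCA -!mulrDr.
rewrite [leRHS]mulrCA ler_wpM2l ?exprn_ge0 ?subr_ge0//.
rewrite [leRHS](_ : _ = C * (- eps * phi a + c * phi a)); last by ring.
rewrite [leLHS](_ : _ = C * (L phi a + c * phi a)); last by ring.
by rewrite ler_wpM2l// lerD2r phi_decay.
Qed.

(* With [S = L + c], a positive operator, e^{tL} = e^{-ct} e^{tS}. *)
Lemma markov_semigroup_decay (g : T -> R) (C t : R) (a : T) :
  0 <= C -> (forall a, D a -> `|g a| <= C * phi a) -> D a -> 0 <= t ->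
  cvgn (series (fun n => t ^+ n / n`!%:R * iter n L g a)) /\
  `|markov_semigroup L t g a| <= expR (- eps * t) * (C * phi a).
Proof.
move=> C0 gC Da t0.
pose s k := iter k S g a.
pose u k := exp_coeff t k * s k.
pose v := exp_coeff (- c * t).
have Cphi0 : 0 <= C * phi a by exact: le_trans (gC a Da).
(* The binomial coefficient over [n!] splits into [1/k!] and [1/(n-k)!], so the exponential series
   of [L] is a Cauchy product. *)
have uE n : t ^+ n / n`!%:R * iter n L g a = \sum_(k < n.+1) u k * v (n - k)%N.
  rewrite (iter_sub_scale Llin c) mulr_sumr; apply: eq_bigr => k _.
  have kn : (k <= n)%N by rewrite -ltnS.
  rewrite /u /v /exp_coeff /s /= -(bin_fact kn) !natrM exprMn.
  rewrite -{1}(subnKC kn) exprD.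
  have fk m : m`!%:R != 0 :> R by rewrite pnatr_eq0 -lt0n fact_gt0.
  have Cnk : 'C(n, k)%:R != 0 :> R by rewrite pnatr_eq0 -lt0n bin_gt0.
  by field; rewrite !fk Cnk.
pose w n := C * phi a * exp_coeff ((c - eps) * t) n.
have wE : w = (C * phi a) *: exp_coeff ((c - eps) * t) :> R^nat by [].
have u_le n : `|u n| <= w n.
  rewrite /u normrM ger0_norm ?exp_coeff_ge0//.
  rewrite /w /exp_coeff /= exprMn.
  rewrite [leRHS](_ : _ =
    t ^+ n / n`!%:R * ((c - eps) ^+ n * C * phi a)); last by ring.
  by rewrite ler_wpM2l ?divr_ge0 ?exprn_ge0// iter_shifted_generator_le.
have cvgr : cvgn (series w).
  by rewrite wE; exact/is_cvg_seriesZ/is_cvg_series_exp_coeff.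
have cvgu : cvgn [normed series u].
  apply: (series_le_cvg _ _ u_le) => // n; apply: le_trans (u_le n).
  exact: normr_ge0.
have cvgv : cvgn [normed series v].
  by rewrite /v normed_series_exp_coeff; exact: is_cvg_series_exp_coeff.
have uv := cvg_cauchy_product cvgu cvgv.
rewrite /markov_semigroup.
have -> : (fun n => t ^+ n / n`!%:R * iter n L g a) =
    fun n => \sum_(k < n.+1) u k * v (n - k)%N by apply/funext => n.
split; first by apply/cvg_ex; eexists; exact: uv.
rewrite (cvg_lim _ uv)// normrM.
have -> : limn (series v) = expR (- c * t) by [].
rewrite (ger0_norm (expR_ge0 _)).
have -> : - eps * t = (c - eps) * t + - c * t by ring.
rewrite expRD mulrAC ler_wpM2r ?expR_ge0//.
apply: le_trans (lim_series_norm cvgu) _.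
apply: le_trans (lim_series_le cvgu cvgr u_le) _.
have -> : limn (series w) = C * phi a * expR ((c - eps) * t).
  by rewrite wE lim_seriesZ//; exact: is_cvg_series_exp_coeff.
by rewrite mulrC.
Qed.

(** As [L H = 0], only the term of order zero survives. *)
Lemma cvg_series_harmonic (H : T -> R) (t : R) (a : T) : L H = (fun=> 0) ->
  series (fun n => t ^+ n / n`!%:R * iter n L H a) @ \oo --> H a.
Proof.
move=> LH; rewrite -(cvg_shiftS _); apply: cvg_near_cst; apply: nearW => n.
rewrite /series /= big_nat_recl//= expr0 fact0 divr1 mul1r.
rewrite big1_seq ?addr0// => k _; rewrite -iterS iterSr LH.
suff -> : iter k L (fun=> 0) = fun=> 0 by rewrite mulr0.
by elim: k => //= k ->; exact: generator0.
Qed.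

Lemma cvg_expR_decay (K : R) : expR (- eps * t) * K @[t --> +oo] --> 0.
Proof.
rewrite -[X in _ --> X](mul0r K); apply: cvgM; last exact: cvg_cst.
apply/cvgrPdist_lt => e e0.
have /cvgrPdist_lt/(_ _ e0) [M [_ HM]] := @cvgr_expR R.
exists (M / eps); split; first exact: num_real.
by move=> t; rewrite ltr_pdivrMr// mulNr [eps * t]mulrC => /HM.
Qed.

(** The semigroup fixes [H] and sends the difference between the indicator and [H], dominated by
    [phi], to 0. The domination includes the boundary condition: [H] is the indicator of [b]
    wherever [phi] vanishes on [D]. *)
Lemma absorption_probabilityE (b : T) (H : T -> R) (C : R) (a : T) :
  L H = (fun=> 0) -> 0 <= C ->
  (forall a, D a -> `|\1_[set b] a - H a| <= C * phi a) -> D a ->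
  absorption_probability L a b = H a.
Proof.
move=> LH C0 HC Da; apply: cvg_lim => //.
pose g a := -1 * H a + \1_[set b] a.
have gC a0 : D a0 -> `|g a0| <= C * phi a0.
  by move=> Da0; rewrite /g mulN1r addrC HC.
suff : markov_semigroup L t g a @[t --> +oo] --> 0.
  move=> /(cvgD (cvg_cst (H a))); rewrite addr0; apply: cvg_trans.
  apply: near_eq_cvg; near=> t.
  have t0 : 0 <= t by near: t; exact: nbhs_pinfty_ge.
  have [cg _] := markov_semigroup_decay C0 gC Da t0.
  apply/esym/cvg_lim => //.
  have Hcvg := @cvg_series_harmonic _ t a LH.
  apply: cvg_trans (cvgD Hcvg cg).
  apply: near_eq_cvg; apply: nearW => n; rewrite fctE /series /= -big_split /=.
  apply: eq_bigr => k _; rewrite -mulrDr; congr (_ * _).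
  suff -> : iter k L g = fun b0 => -1 * iter k L H b0 +
    iter k L (\1_[set b] : T -> R) b0 by rewrite mulN1r addNKr.
  by elim: k => //= k ->; rewrite Llin.
apply: norm_cvg0; apply: (squeeze_cvgr _ (cvg_cst 0)
  (cvg_expR_decay (C * phi a))).
near=> t; rewrite normr_ge0 /=.
have t0 : 0 <= t by near: t; exact: nbhs_pinfty_ge.
by have [] := markov_semigroup_decay C0 gC Da t0.
Unshelve. all: by end_near.
Qed.

(** The semigroup leaves [g] constant in time, yet the bound on it decays exponentially. *)
Lemma harmonic_eq0 (g : T -> R) (C : R) (a : T) :
  L g = (fun=> 0) -> 0 <= C -> (forall a, D a -> `|g a| <= C * phi a) ->
  D a -> g a = 0.
Proof.
move=> Lg C0 gC Da; apply/eqP; rewrite -normr_le0.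
apply: (@ler_cvg_to _ (@pinfty_nbhs R) _ _ (fun=> `|g a|)
  (fun t => expR (- eps * t) * (C * phi a))).
- exact: cvg_cst.
- exact: cvg_expR_decay.
near=> t; have t0 : 0 <= t by near: t; exact: nbhs_pinfty_ge.
have [_] := markov_semigroup_decay C0 gC Da t0.
by rewrite /markov_semigroup (cvg_lim _ (@cvg_series_harmonic _ t a Lg)).
Unshelve. all: by end_near.
Qed.

End Absorption.

(** * Minimum principle and resolvent of a non-degenerate sub-stochastic matrix *)

Section SubstochasticMatrices.
Context {R : realType} {V : finType} (K : V -> V -> R).
Hypothesis Ksub : substochastic K.
Hypothesis Knd : non_degenerate K.

Let K_ge0 x y : 0 <= K x y.
Proof. by have [/(_ x y)/andP[]] := Ksub. Qed.

Lemma killing_rate_ge0 x : 0 <= killing_rate K x.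
Proof. by rewrite subr_ge0; have [_] := Ksub. Qed.

(* The set where a negative minimum is attained would carry a stochastic
   principal sub-matrix. *)
Lemma superharmonic_ge0 (w : V -> R) :
  (forall x, \sum_y K x y * w y <= w x) -> forall x, 0 <= w x.
Proof.
move=> Kw x0; rewrite leNgt; apply/negP => wx0.
have [x1 _ wmin] := @Order.TotalTheory.arg_minP _ _ _ x0 predT w isT.
set m := w x1 in wmin.
have m_lt0 : m < 0 by exact: le_lt_trans (wmin x0 isT) wx0.
pose A := [set x | w x == m]%SET.
apply: (Knd (A := A)).
  by apply/finset.set0Pn; exists x1; rewrite inE.
move=> x; rewrite inE => /eqP wx.
have ge0 y : 0 <= K x y * (w y - m) by rewrite mulr_ge0// subr_ge0 wmin.
(* At a minimum point, a sum of non-negative terms is at most [m] times the killing rate, which is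
   not positive. Both are thus 0: the row sums to 1 and charges only [A]. *)
have sum_le : \sum_y K x y * (w y - m) <= m * (1 - \sum_y K x y).
  under eq_bigr do rewrite mulrBr.
  rewrite sumrB -mulr_suml mulrBr mulr1 [m * _]mulrC lerD2r.
  by rewrite -[leRHS]wx.
have mk_le0 : m * (1 - \sum_y K x y) <= 0.
  by rewrite mulr_le0_ge0 ?(ltW m_lt0)//; exact: killing_rate_ge0.
have sum0 : \sum_y K x y * (w y - m) = 0.
  by apply/eqP; rewrite eq_le (le_trans sum_le mk_le0) sumr_ge0.
have KE : \sum_y K x y = 1.
  have : 0 <= m * (1 - \sum_y K x y) by apply: le_trans sum_le; rewrite sum0.
  rewrite nmulr_rge0// subr_le0 => le1; apply/eqP; rewrite eq_le le1 andbT.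
  by have [_] := Ksub.
rewrite -[RHS]KE big_mkcond; apply: eq_bigr => y _; rewrite inE.
have /eqP := psumr_eq0P (fun y _ => ge0 y) sum0 (i := y) isT.
by rewrite mulf_eq0 subr_eq0; case: ifPn => // _; rewrite orbF => /eqP.
Qed.

Lemma harmonic_unique (b w w' : V -> R) :
  (forall x, w x = \sum_y K x y * w y + b x) ->
  (forall x, w' x = \sum_y K x y * w' y + b x) -> w =1 w'.
Proof.
move=> wE w'E x; apply/eqP; rewrite eq_le.
have diff u v : (forall x, u x = \sum_y K x y * u y + b x) ->
    (forall x, v x = \sum_y K x y * v y + b x) -> 0 <= u x - v x.
  move=> uE vE; apply: (@superharmonic_ge0 (fun x => u x - v x)) => {}x.
  under eq_bigr do rewrite mulrBr.
  by rewrite sumrB [u x]uE [v x]vE opprD addrACA subrr addr0.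
by rewrite -subr_ge0 diff//= -subr_ge0 diff.
Qed.

(** By uniqueness [1 - K] is injective, hence invertible in finite dimension. *)
Lemma resolvent_exists (b : V -> R) :
  exists w : V -> R, forall x, w x = \sum_y K x y * w y + b x.
Proof.
(* This is the transpose of [1 - K], so that functions on [V] act as row vectors. *)
pose M : 'M[R]_#|V| := \matrix_(i, j)
  ((i == j)%:R - K (enum_val j) (enum_val i)).
have mulM (u : 'rV_#|V|) j : (u *m M) 0 j =
    u 0 j - \sum_y K (enum_val j) y * u 0 (enum_rank y).
  rewrite mxE; under eq_bigr do rewrite mxE mulrBr.
  rewrite sumrB; congr (_ - _).
    rewrite (bigD1 j)//= eqxx mulr1 big1 ?addr0// => i /negPf ->.
    by rewrite mulr0.
  by rewrite -[RHS]sum_enum_val; apply: eq_bigr => i _; rewrite enum_valK mulrC.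
have Munit : M \in unitmx.
  rewrite -row_free_unit -kermx_eq0; apply/rowV0P => u /sub_kermxP uM0.
  have u0 : forall x, u 0 (enum_rank x) = 0.
    apply: (@harmonic_unique (fun=> 0)) => x; last first.
      by rewrite big1 ?addr0// => y _; rewrite mulr0.
    have := mulM u (enum_rank x); rewrite uM0 mxE enum_rankK addr0.
    by move=> /esym/eqP; rewrite subr_eq0 => /eqP.
  by apply/rowP => i; rewrite mxE -(enum_valK i) u0.
pose u := (\row_j b (enum_val j)) *m invmx M.
exists (fun x => u 0 (enum_rank x)) => x.
have := mulM u (enum_rank x); rewrite mulmxKV// mxE enum_rankK => ->.
by rewrite addrC subrK.
Qed.

End SubstochasticMatrices.

(** * Dirichlet problems and hitting probabilities *)

Section HittingProbabilities.
Context {R : realType} {V : finType}.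
Implicit Types (K : V -> V -> R) (G : {set V}).

(** With the rows outside [G] set to zero, the resolvent equation there reads [w = b]: a boundary
    value problem on [G] becomes a resolvent equation on all of [V]. *)
Definition restrict_rows G K x y : R := if x \in G then K x y else 0.

Lemma sum_restrict_rows G K (w : V -> R) x :
  \sum_y restrict_rows G K x y * w y =
  if x \in G then \sum_y K x y * w y else 0.
Proof.
rewrite /restrict_rows; case: ifP => // _.
by rewrite big1// => y _; rewrite mul0r.
Qed.

Lemma restrict_rows_substochastic G K :
  substochastic K -> substochastic (restrict_rows G K).
Proof.
move=> [K01 Ksum]; split=> [x y|x]; rewrite /restrict_rows.
  by case: (x \in G) => //; rewrite lexx ler01.
by case: (x \in G) => //; rewrite big1.
Qed.

(** A zero row is not stochastic, so a stochastic principal sub-matrix would use only unchanged rows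
    of [K]. *)
Lemma restrict_rows_non_degenerate G K :
  non_degenerate K -> non_degenerate (restrict_rows G K).
Proof.
move=> Knd A A0 Astoch; apply: (Knd A A0) => x xA; rewrite -[RHS](Astoch x xA).
apply: eq_bigr => y yA; rewrite /restrict_rows; case: ifPn => // xG.
have /esym/eqP := Astoch x xA; rewrite big1 ?oner_eq0// => z _.
by rewrite /restrict_rows (negPf xG).
Qed.

Section Fixed.
Context (K : V -> V -> R).
Hypothesis Ksub : substochastic K.
Hypothesis Knd : non_degenerate K.

Let K_ge0 x y : 0 <= K x y.
Proof. by have [/(_ x y)/andP[]] := Ksub. Qed.

Lemma restricted_superharmonic_ge0 G (w : V -> R) :
  (forall x, x \in G -> \sum_y K x y * w y <= w x) ->
  (forall x, x \notin G -> 0 <= w x) -> forall x, 0 <= w x.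
Proof.
move=> wG wnG; apply: (superharmonic_ge0 (restrict_rows_substochastic G Ksub)
  (restrict_rows_non_degenerate (G := G) Knd)) => x.
by rewrite sum_restrict_rows; case: ifPn => [/wG|/wnG].
Qed.

Lemma dirichlet_exists G (b : V -> R) : exists w : V -> R,
  (forall x, x \in G -> w x = \sum_y K x y * w y + b x) /\
  (forall x, x \notin G -> w x = b x).
Proof.
have [w wE] := resolvent_exists (restrict_rows_substochastic G Ksub)
  (restrict_rows_non_degenerate (G := G) Knd) b.
exists w; split=> x xG; rewrite wE sum_restrict_rows ?xG//.
by rewrite (negPf xG) add0r.
Qed.

Lemma dirichlet_unique G (b w w' : V -> R) :
  (forall x, x \in G -> w x = \sum_y K x y * w y + b x) ->
  (forall x, x \in G -> w' x = \sum_y K x y * w' y + b x) ->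
  (forall x, x \notin G -> w x = w' x) -> w =1 w'.
Proof.
move=> wE w'E ww' x; apply/eqP; rewrite eq_le.
have diff u v : (forall x, x \in G -> u x = \sum_y K x y * u y + b x) ->
    (forall x, x \in G -> v x = \sum_y K x y * v y + b x) ->
    (forall x, x \notin G -> u x = v x) -> 0 <= u x - v x.
  move=> uE vE uv; apply: (@restricted_superharmonic_ge0 G
    (fun x => u x - v x)) => {}x xG; last by rewrite uv// subrr.
  under eq_bigr do rewrite mulrBr.
  by rewrite sumrB [u x]uE// [v x]vE// opprD addrACA subrr addr0.
by rewrite -subr_ge0 diff//= => [|y /ww' ->//]; rewrite -subr_ge0 diff.
Qed.

(** [h y] is the probability that a walk from [y] hits [x]. The bounds come from the minimum
    principle for [h] and for [1 - h], superharmonic off [x] because rows sum to at most 1. *)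
Lemma hitting_function_exists x : exists h : V -> R,
  [/\ h x = 1, forall y, y != x -> h y = \sum_z K y z * h z
    & forall y, 0 <= h y <= 1].
Proof.
have [h [hE hx]] := dirichlet_exists [set~ x]%SET (fun y => (y == x)%:R).
have h1 : h x = 1 by rewrite hx ?inE ?eqxx.
have hK y : y != x -> h y = \sum_z K y z * h z.
  by move=> yx; rewrite hE ?inE// (negPf yx) addr0.
have bnd : forall y, y \notin [set~ x]%SET -> y = x.
  by move=> y; rewrite !inE negbK => /eqP.
exists h; split=> // y; apply/andP; split.
  apply: (@restricted_superharmonic_ge0 [set~ x]%SET) => [z|z /bnd ->].
    by rewrite !inE => /hK <-.
  by rewrite h1.
rewrite -subr_ge0; move: y.
apply: (@restricted_superharmonic_ge0 [set~ x]%SET (fun y => 1 - h y)).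
  move=> z; rewrite !inE => /hK ->; under eq_bigr do rewrite mulrBr mulr1.
  by rewrite sumrB lerD2r; have [_] := Ksub.
by move=> z /bnd ->; rewrite h1 subrr.
Qed.

Lemma hitting_probabilityE nu x (h : V -> R) : h x = 1 ->
  (forall y, y != x -> h y = \sum_z K y z * h z) ->
  (forall y, 0 <= h y <= 1) ->
  hitting_probability K nu x = \sum_y nu y * h y.
Proof.
move=> hx hK h01; apply: eq_bigr => y0 _; congr (_ * _).
(* [w] is the expected absorption time of the stopped walk, whose jumps and killing have total rate
   1 off [x]; it serves as Lyapunov function. *)
have [w [wE wx]] := dirichlet_exists [set~ x]%SET (fun y => (y != x)%:R).
have {}wx : w x = 0 by rewrite wx ?inE eqxx.
have {}wE y : y != x -> w y = \sum_z K y z * w z + 1.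
  by move=> yx; rewrite wE ?inE// yx.
have w_ge0 : forall y, 0 <= w y.
  apply: (@restricted_superharmonic_ge0 [set~ x]%SET) => y; rewrite !inE.
    by move=> yx; rewrite [leRHS]wE// lerDl.
  by rewrite negbK => /eqP ->; rewrite wx.
have w_ge1 y : y != x -> 1 <= w y.
  by move=> /wE ->; rewrite lerDr sumr_ge0// => z _; rewrite mulr_ge0.
pose W := 1 + \sum_y w y.
have W_ge1 : 1 <= W by rewrite lerDl sumr_ge0.
have W_gt0 : 0 < W by exact: lt_le_trans W_ge1.
have w_le y : w y <= W.
  by rewrite /W (bigD1 y)//= addrCA lerDl addr_ge0// sumr_ge0.
pose phi a := if a is Some y then w y else 0.
pose H a := if a is Some y then h y else 0.
have killE y : \sum_z K y z + killing_rate K y = 1.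
  by rewrite /killing_rate addrC subrK.
have genE f y : y != x -> stopped_walk_generator K x f (Some y) =
    \sum_z K y z * f (Some z) + killing_rate K y * f None - f (Some y).
  move=> /negPf yx; rewrite /stopped_walk_generator yx.
  under eq_bigr do rewrite mulrBr.
  rewrite sumrB -mulr_suml -[X in _ = _ - X]mul1r -(killE y); ring.
(* The shift [1] is the total rate out of a site. The generator lowers [phi] at unit rate off the
   absorbing states and [phi <= W], hence the decay rate [W^-1]; [W >= 1] keeps it below the
   shift. *)
apply: (@absorption_probabilityE _ _ _ (fun=> True) phi 1 W^-1
  _ _ _ _ _ (Some x) H 1) => //.
- move=> k f g; apply/funext => -[y|]; last by rewrite /= mulr0 addr0.
  have [->|yx] := eqVneq y x; first by rewrite /= eqxx mulr0 addr0.
  rewrite !genE// -[LHS]/(_ - _).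
  under eq_bigr do rewrite mulrDr mulrCA.
  rewrite big_split -mulr_sumr /=; ring.
- move=> f g fg [y|] _; last by rewrite /= !add0r !mul1r fg.
  have [->|yx] := eqVneq y x; first by rewrite /= eqxx !add0r !mul1r fg.
  rewrite !genE// !mul1r !subrK (le_trans (ler_normD _ _))// lerD//.
    rewrite (le_trans (ler_norm_sum _ _ _))// ler_sum// => z _.
    by rewrite normrM ger0_norm// ler_wpM2l// fg.
  have k0 := killing_rate_ge0 Ksub y.
  by rewrite normrM ger0_norm// ler_wpM2l// fg.
- by rewrite invr_gt0.
- by rewrite invf_le1.
- move=> [y|] _; last by rewrite /= mulr0.
  have [->|yx] := eqVneq y x; first by rewrite /= eqxx wx mulr0.
  rewrite genE//= mulr0 addr0 {1}(wE y yx) opprD addNKr mulNr lerN2.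
  by rewrite mulrC ler_pdivrMr// mul1r.
- apply/funext => -[y|] //.
  have [->|yx] := eqVneq y x; first by rewrite /= eqxx.
  by rewrite genE//= mulr0 addr0 -hK// subrr.
- move=> [y|] _; rewrite indicE mul1r /= classical_sets.in_set1.
    have [->|yx] := eqVneq y x; first by rewrite hx eqxx subrr normr0 wx.
    rewrite (inj_eq Some_inj) (negPf yx) sub0r normrN.
    have /andP[h0 h1] := h01 y.
    by rewrite ger0_norm// (le_trans h1)// w_ge1.
  by rewrite subrr normr0.
Qed.

Lemma hitting_probability_le1 nu x : prob_distribution nu ->
  hitting_probability K nu x <= 1.
Proof.
move=> [nu0 nu1]; have [h [hx hK h01]] := hitting_function_exists x.
rewrite (hitting_probabilityE nu hx hK h01) -nu1 ler_sum// => y _.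
by rewrite ler_piMr//; have /andP[] := h01 y.
Qed.

(** Positivity of the hitting function propagates backwards from [x] along a path of positive rates
    starting in the support of [nu]. *)
Lemma hitting_probability_gt0 nu x : prob_distribution nu ->
  admissible K nu -> 0 < hitting_probability K nu x.
Proof.
move=> [nu0 nu1] /(_ x)[y nuy yx].
have [h [hx hK h01]] := hitting_function_exists x.
have h0 z : 0 <= h z by have /andP[] := h01 z.
rewrite (hitting_probabilityE nu hx hK h01).
suff hy : 0 < h y.
  rewrite (bigD1 y)//= ltr_wpDr ?mulr_gt0// sumr_ge0// => z _.
  by rewrite mulr_ge0.
have /connectP[p] := yx; elim: p y {nuy yx} => [|z p IH] y /=.
  by move=> _ <-; rewrite hx.
move=> /andP[Kyz pz] lastx; have hz := IH z pz lastx.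
have [->|yx] := eqVneq y x; first by rewrite hx.
rewrite hK// (bigD1 z)//= ltr_wpDr ?mulr_gt0// sumr_ge0// => u _.
by rewrite mulr_ge0.
Qed.

End Fixed.
End HittingProbabilities.

(** * Instructions at a site and their commutation *)

Section Toppling.
Context {V : finType}.
Implicit Types (eta : config V) (x y : V).

(** Writing every move as a change of one site reduces commutation to identities between maps of
    [option nat]. *)
Definition update_site (phi : option nat -> option nat) x eta : config V :=
  [ffun z => if z == x then phi (eta z) else eta z].

Definition site_add (v : option nat) : option nat :=
  Some (if v is Some k then k.+1 else 2).
Definition site_remove (v : option nat) : option nat := Some (odflt 0%N v).-1.
Definition site_sleep (v : option nat) : option nat :=
  if v == Some 1%N then None else v.

Lemma add_particleE eta x : add_particle eta x = update_site site_add x eta.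
Proof. by apply/ffunP => z; rewrite !ffunE; case: eqP => // ->. Qed.

Lemma remove_particleE eta x :
  remove_particle eta x = update_site site_remove x eta.
Proof. by apply/ffunP => z; rewrite !ffunE; case: eqP => // ->. Qed.

Lemma update_site_sleepE eta x :
  update_site site_sleep x eta =
  if eta x == Some 1%N then fall_asleep eta x else eta.
Proof.
apply/ffunP => z; rewrite ffunE /site_sleep.
by case: eqP => [->|/eqP zx]; case: ifP => // _;
  rewrite ffunE ?eqxx ?(negPf zx).
Qed.

Lemma update_siteC phi psi x y eta :
  (x = y -> phi (psi (eta x)) = psi (phi (eta x))) ->
  update_site phi x (update_site psi y eta) =
  update_site psi y (update_site phi x eta).
Proof.
move=> H; apply/ffunP => z; rewrite !ffunE.
have [zx|zx] := eqVneq z x; have [zy|zy] := eqVneq z y => //.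
by rewrite zx H// -zx.
Qed.

Definition active eta x : bool := (0 < active_particles eta x)%N.

Lemma active_add eta x y : active eta x -> active (add_particle eta y) x.
Proof.
rewrite /active /active_particles add_particleE ffunE.
by case: eqP => // _; case: (eta x).
Qed.

(* The instructions of an abelian network: [inl y] is a jump to y, [inr true]
   a killing and [inr false] an attempt to fall asleep, which fails when the
   particle is not alone. *)
Definition instruction : finType := (V + bool)%type.
Implicit Type i : instruction.

Definition local_effect i : option nat -> option nat :=
  if i is inr false then site_sleep else site_remove.

Definition landing i eta : config V :=
  if i is inl y then add_particle eta y else eta.

Definition execute eta x i : config V :=
  landing i (update_site (local_effect i) x eta).

Lemma landingC i j eta : landing i (landing j eta) = landing j (landing i eta).
Proof.
case: i => [y|?]; case: j => [z|?] //=.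
by rewrite !add_particleE update_siteC.
Qed.

(** The local source of the abelian property. At an active site, an arrival commutes with a
    departure; a lone particle that falls asleep is woken by the arrival, which leaves two active
    particles, just as when the attempt to sleep comes second and fails. *)
Lemma landing_local_effect i j eta x : active eta x ->
  update_site (local_effect j) x (landing i eta) =
  landing i (update_site (local_effect j) x eta).
Proof.
case: i => [y|?] //=; rewrite !add_particleE => act; apply: update_siteC => _.
move: act; rewrite /active /active_particles.
by case: (eta x) => [[|[|k]]|] //; case: j => [?|[]].
Qed.

Lemma active_update phi eta x y : x != y -> active eta y ->
  active (update_site phi x eta) y.
Proof.
by move=> xy; rewrite /active /active_particles ffunE eq_sym (negPf xy).
Qed.

Lemma active_execute eta x y i : x != y -> active eta y ->
  active (execute eta x i) y.
Proof.
move=> xy acty; rewrite /execute /landing; case: i => [z|b] /=.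
  by apply: active_add; apply: active_update.
exact: active_update.
Qed.

Lemma execute_landing eta x i j : active eta x ->
  execute (landing j eta) x i = landing j (execute eta x i).
Proof. by move=> act; rewrite /execute landing_local_effect// landingC. Qed.

Lemma executeC eta x y i j : x != y -> active eta x -> active eta y ->
  execute (execute eta x i) y j = execute (execute eta y j) x i.
Proof.
move=> xy actx acty; rewrite /execute.
rewrite landing_local_effect ?active_update//.
rewrite landing_local_effect ?active_update 1?eq_sym//.
by rewrite landingC (update_siteC (x := x))// => /eqP; rewrite (negPf xy).
Qed.

Definition stable eta : bool := ~~ [exists x, active eta x].

Lemma stable_configP eta : stable eta -> exists A, eta = stable_config A.
Proof.
rewrite /stable negb_exists => /forallP st; exists [set x | eta x == None]%SET.
apply/ffunP => x; rewrite ffunE inE; move: (st x).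
by rewrite /active /active_particles; case: (eta x) => [[|k]|].
Qed.

Lemma stable_stable_config A : stable (stable_config A : config V).
Proof.
rewrite /stable negb_exists; apply/forallP => x.
rewrite /active /active_particles.
by rewrite ffunE; case: ifP.
Qed.

Lemma stable_config_inj : injective (@stable_config V).
Proof.
move=> A B AB; apply/finset.setP => x; move/ffunP/(_ x): AB; rewrite !ffunE.
by case: ifP; case: ifP.
Qed.

End Toppling.

(** * Toppling operators, local harmonicity and stabilization probabilities *)

Section ActivatedRandomWalks.
Context {R : realType} {V : finType} (K : V -> V -> R) (lambda : R).
Hypothesis Ksub : substochastic K.
Hypothesis Knd : non_degenerate K.
Hypothesis lambda_gt0 : 0 < lambda.
Implicit Types (eta : config V) (f g : config V -> R) (B : {set V}).

Let K_ge0 x y : 0 <= K x y.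
Proof. by have [/(_ x y)/andP[]] := Ksub. Qed.

Let lambda1_gt0 : 0 < 1 + lambda.
Proof. by rewrite addr_gt0. Qed.

Let sum_killing x : \sum_y K x y + killing_rate K x = 1.
Proof. by rewrite /killing_rate addrC subrK. Qed.

(** The law of the next instruction at [x]: each active particle receives instructions at total rate
    [1 + lambda], counting attempts to sleep that fail. *)
Definition instruction_weight (x : V) (i : @instruction V) : R :=
  match i with
  | inl y => K x y
  | inr true => killing_rate K x
  | inr false => lambda
  end / (1 + lambda).

Lemma instruction_weight_ge0 x i : 0 <= instruction_weight x i.
Proof.
rewrite divr_ge0 ?(ltW lambda1_gt0)//; case: i => [//|[]].
  exact: killing_rate_ge0.
exact: ltW.
Qed.

Definition topple f eta x : R :=
  \sum_i instruction_weight x i * f (execute eta x i).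

Lemma toppleE f eta x : (1 + lambda) * topple f eta x =
  \sum_y K x y * f (add_particle (remove_particle eta x) y) +
  killing_rate K x * f (remove_particle eta x) +
  lambda * f (update_site site_sleep x eta).
Proof.
rewrite /topple big_sumType big_bool /= /execute /= mulrDr mulr_sumr.
rewrite -remove_particleE /instruction_weight mulrDr addrA.
have l0 : 1 + lambda != 0 by rewrite gt_eqF.
congr (_ + _ + _); last by field.
  by apply: eq_bigr => y _; field.
by field.
Qed.

Lemma sum_instruction_weight x : \sum_i instruction_weight x i = 1.
Proof.
have l0 : 1 + lambda != 0 by rewrite gt_eqF.
apply: (mulfI l0); rewrite mulr1.
have := toppleE (fun=> 1) [ffun=> None] x; rewrite /topple.
under eq_bigr do rewrite mulr1.
by move=> ->; under eq_bigr do rewrite mulr1; rewrite !mulr1 sum_killing.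
Qed.

Lemma ler_topple f g eta x :
  (forall i, f (execute eta x i) <= g (execute eta x i)) ->
  topple f eta x <= topple g eta x.
Proof.
by move=> fg; apply: ler_sum => i _; rewrite ler_wpM2l ?instruction_weight_ge0.
Qed.

Lemma topple_cst (k : R) eta x : topple (fun=> k) eta x = k.
Proof. by rewrite /topple -mulr_suml sum_instruction_weight mul1r. Qed.

Lemma toppleD f g (k : R) eta x :
  topple (fun a => k * f a + g a) eta x =
  k * topple f eta x + topple g eta x.
Proof.
rewrite /topple mulr_sumr -big_split; apply: eq_bigr => i _ /=; ring.
Qed.

Lemma norm_topple_le f g eta x :
  (forall i, `|f (execute eta x i)| <= g (execute eta x i)) ->
  `|topple f eta x| <= topple g eta x.
Proof.
move=> fg; apply: le_trans (ler_norm_sum _ _ _) _; apply: ler_sum => i _.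
by rewrite normrM ger0_norm ?instruction_weight_ge0// ler_wpM2l
  ?instruction_weight_ge0.
Qed.

(** Failed attempts to sleep change nothing, so they may be included at rate [lambda] for every
    active particle. *)
Lemma arw_generatorE f eta : arw_generator K lambda f eta =
  \sum_x (active_particles eta x)%:R *
    ((1 + lambda) * (topple f eta x - f eta)).
Proof.
rewrite /arw_generator [X in _ + X]big_mkcond -big_split /=.
apply: eq_bigr => x _.
rewrite [(1 + lambda) * _]mulrBr toppleE update_site_sleepE.
have -> : \sum_y K x y * (f (add_particle (remove_particle eta x) y) - f eta) =
    \sum_y K x y * f (add_particle (remove_particle eta x) y) -
    (1 - killing_rate K x) * f eta.
  under eq_bigr do rewrite mulrBr.
  by rewrite sumrB -mulr_suml /killing_rate subKr.
case: ifPn => [/eqP ex|_]; last by rewrite addr0; congr (_ * _); ring.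
by rewrite /active_particles ex /=; ring.
Qed.

(** Harmonicity at each active site separately, which is stronger than being annihilated by the
    generator. *)
Definition locally_harmonic f : Prop :=
  forall eta x, active eta x -> f eta = topple f eta x.

Lemma locally_harmonic_generator f :
  locally_harmonic f -> arw_generator K lambda f = fun=> 0.
Proof.
move=> fH; apply/funext => eta; rewrite arw_generatorE big1// => x _.
have [k0|] := posnP (active_particles eta x); first by rewrite k0 mul0r.
by move=> /fH <-; rewrite subrr !mulr0.
Qed.

Lemma locally_harmonic_sum (I : finType) (a : I -> R) (F : I -> config V -> R) :
  (forall i, locally_harmonic (F i)) ->
  locally_harmonic (fun eta => \sum_i a i * F i eta).
Proof.
move=> FH eta x act; rewrite /topple; under [RHS]eq_bigr do rewrite mulr_sumr.
rewrite exchange_big; apply: eq_bigr => i _; rewrite (FH i _ _ act) mulr_sumr.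
by apply: eq_bigr => j _; rewrite mulrCA.
Qed.

(** An arrival keeps active sites active and commutes with the instructions executed there. *)
Lemma locally_harmonic_add f y : locally_harmonic f ->
  locally_harmonic (fun eta => f (add_particle eta y)).
Proof.
move=> fH eta x act; rewrite (fH _ _ (active_add y act)); apply: eq_bigr => i _.
by rewrite -[add_particle eta y]/(landing (inl y) eta) execute_landing.
Qed.

Lemma topple_topple_comm f eta x y : x != y -> active eta x -> active eta y ->
  topple (fun e => topple f e y) eta x = topple (fun e => topple f e x) eta y.
Proof.
move=> xy actx acty; rewrite /topple.
under eq_bigr do rewrite mulr_sumr.
under [RHS]eq_bigr do rewrite mulr_sumr.
rewrite exchange_big; apply: eq_bigr => j _; apply: eq_bigr => i _.
by rewrite mulrCA executeC.
Qed.

(* The probability of stabilizing to B within n topplings, for one arbitrary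
   choice of the order of the topplings. *)
Fixpoint stabilization_within B n eta : R :=
  if [pick x | active eta x] is Some x then
    if n is m.+1 then topple (stabilization_within B m) eta x else 0
  else (eta == stable_config B)%:R.

(* Topplings at distinct active sites commute, and neither deactivates the site
   of the other. *)
Lemma stabilization_within_topple B n eta x : active eta x ->
  stabilization_within B n.+1 eta = topple (stabilization_within B n) eta x.
Proof.
elim: n eta x => [|n IH] eta x actx.
  rewrite /=; case: pickP => [y acty|/(_ x)]; last by rewrite actx.
  have [->//|yx] := eqVneq y x.
  (* No toppling is left after the first one and the other site is still active, so both sides
     vanish. *)
  rewrite /topple [LHS]big1 ?[RHS]big1// => i _.
    case: pickP => [|/(_ y)]; first by rewrite mulr0.
    by rewrite active_execute 1?eq_sym.
  case: pickP => [|/(_ x)]; first by rewrite mulr0.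
  by rewrite active_execute.
rewrite [LHS]/=; case: pickP => [y acty|/(_ x)]; last by rewrite actx.
have [->//|yx] := eqVneq y x.
transitivity (topple (fun e => topple (stabilization_within B n) e x) eta y).
  by apply: eq_bigr => i _; rewrite -IH// active_execute.
rewrite topple_topple_comm//; apply: eq_bigr => i _.
by rewrite -IH// active_execute 1?eq_sym.
Qed.

Lemma stabilization_within_stable B n eta : stable eta ->
  stabilization_within B n eta = (eta == stable_config B)%:R.
Proof.
rewrite /stable negb_exists => /forallP st.
by case: n => [|n] /=; case: pickP => // x; rewrite (negPf (st x)).
Qed.

Lemma stabilization_within_bounds B n eta :
  0 <= stabilization_within B n eta <= 1.
Proof.
elim: n eta => [|n IH] eta /=; case: pickP => [x _|_];
  rewrite ?lexx ?ler01 ?ler0n ?lern1 ?leq_b1//.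
apply/andP; split; [rewrite -[leLHS](topple_cst 0 eta x)|
  rewrite -[leRHS](topple_cst 1 eta x)]; apply: ler_topple => i;
  by have /andP[] := IH (execute eta x i).
Qed.

Lemma nondecreasing_stabilization_within B eta :
  nondecreasing_seq (fun n => stabilization_within B n eta).
Proof.
apply/nondecreasing_seqP => n; elim: n eta => [|n IH] eta.
  rewrite [leLHS]/=; case: pickP => [x _|none].
    by have /andP[] := stabilization_within_bounds B 1 eta.
  by rewrite /=; case: pickP => // x; rewrite none.
by rewrite [leLHS]/= [leRHS]/=; case: pickP => // x _; exact: ler_topple.
Qed.

Definition stabilization B eta : R :=
  limn (fun n => stabilization_within B n eta).

Lemma cvg_stabilization B eta :
  stabilization_within B n eta @[n --> \oo] --> stabilization B eta.
Proof.
apply: nondecreasing_is_cvgn; first exact: nondecreasing_stabilization_within.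
by exists 1 => _ [n _ <-]; have /andP[] := stabilization_within_bounds B n eta.
Qed.

Lemma stabilization_ge0 B eta : 0 <= stabilization B eta.
Proof.
apply: limr_ge; first exact: cvg_stabilization.
by apply: nearW => n; have /andP[] := stabilization_within_bounds B n eta.
Qed.

Lemma stabilization_le1 B eta : stabilization B eta <= 1.
Proof.
apply: limr_le; first exact: cvg_stabilization.
by apply: nearW => n; have /andP[] := stabilization_within_bounds B n eta.
Qed.

Lemma stabilization_stable B eta : stable eta ->
  stabilization B eta = (eta == stable_config B)%:R.
Proof.
move=> st; apply: cvg_lim => //; apply: cvg_near_cst.
by apply: nearW => n; exact: stabilization_within_stable.
Qed.

Lemma stabilization_locally_harmonic B : locally_harmonic (stabilization B).
Proof.
move=> eta x act; apply: cvg_lim => //; rewrite -(cvg_shiftS _).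
rewrite [X in X @ _](_ : _ =
  fun n => topple (stabilization_within B n) eta x); last first.
  by apply/funext => n; exact: stabilization_within_topple.
rewrite /topple; elim: (index_enum _) => [|i r IH].
  under eq_fun do rewrite big_nil.
  by rewrite big_nil; exact: cvg_cst.
under eq_fun do rewrite big_cons.
rewrite big_cons; apply: cvgD IH.
by apply: cvgM; [exact: cvg_cst|exact: cvg_stabilization].
Qed.

(** * Weighted particle counts and a Lyapunov function for the ARW generator *)

Definition particle_weight (w : V -> R) eta : R :=
  \sum_x (odflt 1%N (eta x))%:R * w x.

Lemma particle_weight_update w phi x eta (d : R) :
  (odflt 1%N (phi (eta x)))%:R = (odflt 1%N (eta x))%:R + d ->
  particle_weight w (update_site phi x eta) = particle_weight w eta + d * w x.
Proof.
move=> H; rewrite /particle_weight (bigD1 x)//= [in RHS](bigD1 x)//=.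
rewrite ffunE eqxx H mulrDl -!addrA; congr (_ + _); rewrite addrC.
congr (_ + _); apply: eq_bigr => y yx; by rewrite ffunE (negPf yx).
Qed.

Lemma particle_weight_add w eta x :
  particle_weight w (add_particle eta x) = particle_weight w eta + w x.
Proof.
rewrite add_particleE (particle_weight_update w (d := 1)) ?mul1r//.
by case: (eta x) => [k|] /=; rewrite natr1.
Qed.

Lemma particle_weight_remove w eta x : active eta x ->
  particle_weight w (remove_particle eta x) = particle_weight w eta - w x.
Proof.
move=> act; rewrite remove_particleE.
rewrite (particle_weight_update w (d := -1)) ?mulN1r//.
move: act; rewrite /active /active_particles; case: (eta x) => [[|k]|]//= _.
by rewrite -natr1 addrK.
Qed.

Lemma particle_weight_sleep w eta x :
  particle_weight w (update_site site_sleep x eta) = particle_weight w eta.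
Proof.
rewrite (particle_weight_update w (d := 0)) ?mul0r ?addr0//.
by case: (eta x) => [[|[|k]]|].
Qed.

(** The weight is additive over particles, so only the walk of the toppled particle matters. *)
Lemma topple_particle_weight w eta x : active eta x ->
  (1 + lambda) * (topple (particle_weight w) eta x - particle_weight w eta) =
  \sum_y K x y * w y - w x.
Proof.
move=> act; rewrite mulrBr toppleE particle_weight_sleep.
under eq_bigr do rewrite particle_weight_add particle_weight_remove// mulrDr.
rewrite big_split -mulr_suml /= particle_weight_remove//.
rewrite -[X in X * _ + _ + _ + _](addrK (killing_rate K x)) sum_killing.
by ring.
Qed.

(** Sleeping particles count, as the default in [particle_weight] is 1 and not 0. *)
Let particles := particle_weight (fun=> 1).

Lemma particles_execute eta x i : active eta x ->
  particles (execute eta x i) <= particles eta.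
Proof.
move=> act; rewrite /execute /landing; case: i => [y|[]] /=.
- rewrite -remove_particleE /particles particle_weight_add.
  by rewrite particle_weight_remove// subrK.
- by rewrite -remove_particleE /particles particle_weight_remove// gerBl.
- by rewrite /particles particle_weight_sleep.
Qed.

Section Lyapunov.
Context (N : R).

(* Off the stable configurations, phi sums the expected remaining lifetimes of
   the particles were they to move forever; the generator lowers this sum at a
   rate equal to the number of active particles. *)
Lemma arw_lyapunov : exists phi c eps,
  [/\ 0 < eps <= c,
     (forall f g, (forall a, particles a <= N -> `|f a| <= g a) ->
       forall a, particles a <= N ->
         `|arw_generator K lambda f a + c * f a| <=
           arw_generator K lambda g a + c * g a),
     (forall a, particles a <= N ->
       arw_generator K lambda phi a <= - eps * phi a)
   & forall a, particles a <= N -> if stable a then phi a = 0 else 1 <= phi a].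
Proof.
have [w wE] := resolvent_exists Ksub Knd (fun=> 1).
have w_ge0 : forall x, 0 <= w x.
  by apply: (superharmonic_ge0 Ksub Knd) => x; rewrite [leRHS]wE lerDl.
have w_ge1 x : 1 <= w x.
  by rewrite wE lerDr sumr_ge0// => z _; rewrite mulr_ge0.
pose phi a := if stable a then 0 else particle_weight w a.
pose M := `|N|.
pose Z := 1 + (\sum_x w x) * M.
have M0 : 0 <= M by exact: normr_ge0.
have Z_ge1 : 1 <= Z by rewrite lerDl mulr_ge0// sumr_ge0.
have Z_gt0 : 0 < Z by exact: lt_le_trans Z_ge1.
have W_ge0 a : 0 <= particle_weight w a.
  by rewrite sumr_ge0// => x _; rewrite mulr_ge0.
have phi_le a : phi a <= particle_weight w a by rewrite /phi; case: ifP.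
have W_le a : particles a <= N -> particle_weight w a <= Z.
  move=> aN; apply: (@le_trans _ _ ((\sum_x w x) * M)); last by rewrite lerDr.
  apply: (@le_trans _ _ ((\sum_x w x) * particles a)).
    rewrite mulr_sumr ler_sum// => x _; rewrite mulr1 mulrC ler_wpM2r//.
    by rewrite (bigD1 x)//= lerDl sumr_ge0.
  by rewrite ler_wpM2l ?sumr_ge0// (le_trans aN)// ler_norm.
have active_le a : \sum_x (active_particles a x)%:R <= particles a.
  apply: ler_sum => x _; rewrite mulr1 ler_nat /active_particles.
  by case: (a x).
have active_ge1 a : ~~ stable a -> 1 <= \sum_x (active_particles a x)%:R :> R.
  rewrite /stable negbK => /existsP[x act]; rewrite (bigD1 x)//=.
  by rewrite -[leLHS]addr0 lerD ?sumr_ge0// ler1n.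
(* The shift exceeds the total rate [1 + lambda] per active particle, of which there are at most
   [M]; the extra 1 keeps it above [Z^-1]. The latter works because [phi <= Z] and the generator
   lowers [phi] by at least 1 off the stable configurations. *)
exists phi, (1 + (1 + lambda) * M), Z^-1; split.
- rewrite invr_gt0 Z_gt0 (@le_trans _ _ 1)//; first by rewrite invf_le1.
  by rewrite lerDl mulr_ge0// ltW.
- move=> f g fg a aN.
  have genE h : arw_generator K lambda h a + (1 + (1 + lambda) * M) * h a =
      \sum_x (active_particles a x)%:R * ((1 + lambda) * topple h a x) +
      (1 + (1 + lambda) * (M - \sum_x (active_particles a x)%:R)) * h a.
    rewrite arw_generatorE; under eq_bigr do rewrite mulrBr mulrBr.
    rewrite sumrB -mulr_suml; ring.
  have k_ge0 : 0 <= 1 + (1 + lambda) * (M - \sum_x (active_particles a x)%:R).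
    rewrite addr_ge0// mulr_ge0 ?(ltW lambda1_gt0)// subr_ge0.
    by rewrite (le_trans (active_le a))// (le_trans aN)// ler_norm.
  rewrite !genE (le_trans (ler_normD _ _))// lerD//; last first.
    by rewrite normrM ger0_norm// ler_wpM2l// fg.
  rewrite (le_trans (ler_norm_sum _ _ _))// ler_sum// => x _.
  rewrite normrM ger0_norm//.
  have [->|k0] := posnP (active_particles a x); first by rewrite !mul0r.
  rewrite ler_wpM2l// normrM gtr0_norm// ler_wpM2l ?(ltW lambda1_gt0)//.
  apply: norm_topple_le => i; apply: fg.
  exact: le_trans (particles_execute i k0) aN.
- move=> a aN; rewrite arw_generatorE; have [st|nst] := boolP (stable a).
    rewrite big1 ?{1}/phi ?st ?mulr0// => x _.
    move: st; rewrite /stable negb_exists => /forallP/(_ x).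
    by rewrite /active -eqn0Ngt => /eqP ->; rewrite mul0r.
  apply: (@le_trans _ _ (- \sum_x (active_particles a x)%:R)).
    rewrite -sumrN ler_sum// => x _; rewrite -[leRHS]mulrN1.
    have [->|k0] := posnP (active_particles a x); first by rewrite !mul0r.
    rewrite ler_wpM2l//.
    have -> : -1 = \sum_y K x y * w y - w x by rewrite [w x]wE opprD addNKr.
    rewrite -(topple_particle_weight w k0) ler_wpM2l ?(ltW lambda1_gt0)//.
    (* Putting 0 on stable configurations can only lower the value after the toppling; before it,
       [phi] is the full weight. *)
    by rewrite {2}/phi (negPf nst) lerD2r; exact: ler_topple.
  rewrite mulNr lerN2 (@le_trans _ _ 1) ?active_ge1//.
  by rewrite mulrC ler_pdivrMr// mul1r (le_trans (phi_le a))// W_le.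
- move=> a aN; rewrite /phi; case: (boolP (stable a)) => // nst.
  have /existsP[x act] : [exists x, active a x].
    by move: nst; rewrite /stable negbK.
  rewrite /particle_weight (bigD1 x)//= -[leLHS]addr0 lerD ?sumr_ge0//.
    rewrite -[leLHS]mulr1 ler_pM ?w_ge1//.
    move: act; rewrite /active /active_particles ler1n.
    by case: (a x).
  by move=> y _; rewrite mulr_ge0.
Qed.

End Lyapunov.

(** * Stabilization probabilities and their intertwining with the chain *)

Lemma arw_generator_linear (k : R) f g :
  arw_generator K lambda (fun a => k * f a + g a) =
  fun a => k * arw_generator K lambda f a + arw_generator K lambda g a.
Proof.
apply/funext => a; rewrite !arw_generatorE mulr_sumr -big_split /=.
by apply: eq_bigr => x _; rewrite toppleD; ring.
Qed.

(** The limit over topplings is locally harmonic and has the right values at stable configurations;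
    elsewhere it is at most [1 <= phi]. *)
Lemma stabilization_probabilityE eta B :
  stabilization_probability K lambda eta B = stabilization B eta.
Proof.
have [phi [c [eps [/andP[e0 ec] pos decay phiP]]]] :=
  arw_lyapunov (particles eta).
apply: (absorption_probabilityE arw_generator_linear pos e0 ec decay
  (H := stabilization B) (C := 1)) => //.
  exact/locally_harmonic_generator/stabilization_locally_harmonic.
move=> a /phiP; rewrite indicE mul1r classical_sets.in_set1.
case: ifPn => [st ->|nst].
  by rewrite stabilization_stable// subrr normr0.
apply: le_trans; have -> : (a == stable_config B) = false.
  by apply: contraNF nst => /eqP ->; exact: stable_stable_config.
by rewrite sub0r normrN ger0_norm ?stabilization_ge0// stabilization_le1.
Qed.

(** The difference vanishes at stable configurations and is bounded by a multiple of [phi]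
    elsewhere, so [harmonic_eq0] applies. *)
Lemma locally_harmonic_unique f g (Cf Cg : R) :
  locally_harmonic f -> locally_harmonic g ->
  (forall a, `|f a| <= Cf) -> (forall a, `|g a| <= Cg) ->
  (forall A, f (stable_config A) = g (stable_config A)) -> f =1 g.
Proof.
move=> fH gH fC gC fg eta.
have [phi [c [eps [/andP[e0 ec] pos decay phiP]]]] :=
  arw_lyapunov (particles eta).
suff /eqP : -1 * f eta + g eta = 0.
  by rewrite mulN1r addrC subr_eq0 => /eqP ->.
have C0 : 0 <= Cf + Cg.
  exact: addr_ge0 (le_trans (normr_ge0 _) (fC eta))
    (le_trans (normr_ge0 _) (gC eta)).
apply: (harmonic_eq0 arw_generator_linear pos e0 ec decay
  (g := fun a => -1 * f a + g a) (C := Cf + Cg)) => //.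
  rewrite arw_generator_linear !locally_harmonic_generator//.
  by apply/funext => a; rewrite mulr0 addr0.
move=> a /phiP; case: ifPn => [/stable_configP[A ->] ->|_ phi1].
  by rewrite fg mulN1r addNr normr0 mulr0.
apply: (@le_trans _ _ (Cf + Cg)); last by rewrite ler_peMr.
by rewrite (le_trans (ler_normD _ _))// lerD// mulN1r normrN.
Qed.

(** One may stabilize before or after adding the particle: both sides are bounded and locally
    harmonic in [eta], and agree at stable configurations. *)
Lemma arw_intertwining nu B eta :
  \sum_y nu y * stabilization B (add_particle eta y) =
  \sum_A stabilization A eta * arw_transition K lambda nu A B.
Proof.
have transE A : arw_transition K lambda nu A B =
    \sum_y nu y * stabilization B (add_particle (stable_config A) y).
  by apply: eq_bigr => y _; rewrite stabilization_probabilityE.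
under [RHS]eq_bigr do rewrite mulrC.
have norm_stab C a : `|stabilization C a| <= 1.
  by rewrite ger0_norm ?stabilization_ge0 ?stabilization_le1.
move: eta; apply: (locally_harmonic_unique
  (f := fun eta => \sum_y nu y * stabilization B (add_particle eta y))
  (g := fun eta => \sum_A arw_transition K lambda nu A B * stabilization A eta)
  (Cf := \sum_y `|nu y|) (Cg := \sum_A `|arw_transition K lambda nu A B|)).
- apply: locally_harmonic_sum => y; apply: locally_harmonic_add.
  exact: stabilization_locally_harmonic.
- by apply: locally_harmonic_sum => A; exact: stabilization_locally_harmonic.
- move=> a; rewrite (le_trans (ler_norm_sum _ _ _))// ler_sum// => y _.
  by rewrite normrM ler_piMr.
- move=> a; rewrite (le_trans (ler_norm_sum _ _ _))// ler_sum// => y _.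
  by rewrite normrM ler_piMr.
move=> A; rewrite -transE (bigD1 A)//= big1 => [|A' A'A].
  by rewrite stabilization_stable ?stable_stable_config// eqxx mulr1 addr0.
rewrite stabilization_stable ?stable_stable_config//.
by rewrite (inj_eq stable_config_inj) eq_sym (negPf A'A) mulr0.
Qed.

End ActivatedRandomWalks.

(** * Aggregation of one particle added to a configuration *)

Section Spectrum.
Context {R : realType} {V : finType} (K : V -> V -> R) (lambda : R).
Hypothesis Ksub : substochastic K.
Hypothesis Knd : non_degenerate K.
Hypothesis lambda_gt0 : 0 < lambda.
Implicit Types (eta : config V) (f : config V -> R).

Let K_ge0 x y : 0 <= K x y.
Proof. by have [/(_ x y)/andP[]] := Ksub. Qed.

Definition active_sites eta : {set V} := [set x | active eta x]%SET.

(** The newcomer is not alone at [y], so attempts to sleep fail and their term cancels; what remains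
    is one step of its [K]-walk. *)
Lemma locally_harmonic_add_active f eta y : locally_harmonic K lambda f ->
  active eta y -> f (add_particle eta y) =
    \sum_z K y z * f (add_particle eta z) + killing_rate K y * f eta.
Proof.
move=> fH act; set e := add_particle eta y.
have e2 : exists k, e y = Some k.+2.
  move: act; rewrite /e /active /active_particles add_particleE ffunE eqxx.
  by case: (eta y) => [[|k]|]//= _; exists k.
have rem_e : remove_particle e y = eta.
  apply/ffunP => x; rewrite /e remove_particleE add_particleE !ffunE.
  case: eqP => // ->; move: act; rewrite /active /active_particles.
  by case: (eta y) => [[|k]|].
have act_e : active e y.
  by have [k ek] := e2; rewrite /active /active_particles ek.
have slp_e : update_site site_sleep y e = e.
  by rewrite update_site_sleepE; have [k ->] := e2.
have := toppleE K lambda_gt0 f e y.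
rewrite -(fH _ _ act_e) slp_e rem_e mulrDl mul1r => /addIr.
exact.
Qed.

(* Thin configurations are the states {0,s,1}^V of an internal aggregation
   started from sleeping particles: adding a particle to a thin configuration
   either kills it or turns sites active, and never undoes this. *)
Definition thin eta : bool := [forall x, (active_particles eta x <= 1)%N].

Definition wake eta y : config V := set_site eta y (Some 1%N).

Lemma thin_wake eta y : thin eta -> thin (wake eta y).
Proof.
move=> /forallP th; apply/forallP => x; move: (th x).
by rewrite /active_particles ffunE; case: eqP.
Qed.

Lemma active_sites_wake eta y :
  active_sites (wake eta y) = (y |: active_sites eta)%SET.
Proof.
apply/finset.setP => x; rewrite !inE /active /active_particles ffunE.
by case: eqP.
Qed.

(** The first case is an empty site. At a sleeping particle two active ones result: the woken one,
    and one still to be moved. *)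
Lemma add_particle_inactive eta y : ~~ active eta y ->
  add_particle eta y = wake eta y \/
  add_particle eta y = add_particle (wake eta y) y.
Proof.
rewrite /active /active_particles => nact.
have [e0|e0] := eqVneq (eta y) None; [right|left];
  apply/ffunP => x; rewrite !ffunE ?eqxx; case: (x == y) => //.
  by rewrite e0.
by move: nact e0; case: (eta y) => [[|k]|].
Qed.

(** * Locally harmonic functions that vanish at many active sites *)

Section Vanishing.
Context (f : config V -> R) (n : nat).
Hypothesis fH : locally_harmonic K lambda f.
Hypothesis f0 : forall eta, thin eta -> (n < #|active_sites eta|)%N ->
  f eta = 0.

(** Induction on the number of inactive sites. As a function of [y], the value is [K]-harmonic on
    the active sites; outside them it vanishes, the addition having created one more active site. *)
Lemma locally_harmonic_add_vanish eta y : thin eta ->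
  (n < #|active_sites eta|)%N -> f (add_particle eta y) = 0.
Proof.
have [m] := ubnP (#|V| - #|active_sites eta|).
elim: m eta y => // m IH eta y lem th lt.
suff : (fun y => f (add_particle eta y)) =1 fun=> 0 by exact.
apply: (dirichlet_unique Ksub Knd (G := active_sites eta) (b := fun=> 0)).
- move=> x; rewrite inE => act.
  by rewrite locally_harmonic_add_active// f0// mulr0.
- by move=> x _; rewrite big1 ?addr0// => z _; rewrite mulr0.
move=> x; rewrite inE => nact.
have wcard : #|active_sites (wake eta x)| = #|active_sites eta|.+1.
  by rewrite active_sites_wake cardsU1 inE nact.
have lt' : (n < #|active_sites (wake eta x)|)%N by rewrite wcard ltnW.
have [->|->] := add_particle_inactive nact; first by rewrite f0 ?thin_wake.
apply: IH => //; last exact: thin_wake.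
have : (#|active_sites (wake eta x)| <= #|V|)%N by exact: max_card.
rewrite wcard => lt2; rewrite -ltnS; apply: leq_trans lem.
by rewrite ltnS ltn_sub2l.
Qed.

(** Leaving the active sites creates a new one, where [f] vanishes; only the event, of probability
    [d y], that the particle is killed before leaving contributes. *)
Lemma locally_harmonic_add_maximal eta (d : V -> R) :
  thin eta -> #|active_sites eta| = n ->
  (forall y, active eta y -> d y = \sum_z K y z * d z + killing_rate K y) ->
  (forall y, ~~ active eta y -> d y = 0) ->
  forall y, f (add_particle eta y) = d y * f eta.
Proof.
move=> th cardn dE d0.
apply: (dirichlet_unique Ksub Knd (G := active_sites eta)
  (b := fun y => killing_rate K y * f eta)) => x; rewrite inE => act.
- exact: locally_harmonic_add_active.
- by rewrite dE// mulrDl mulr_suml; under eq_bigr do rewrite -mulrA.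
rewrite d0// mul0r.
have lt : (n < #|active_sites (wake eta x)|)%N.
  by rewrite active_sites_wake cardsU1 inE act cardn.
have [->|->] := add_particle_inactive act; first by rewrite f0 ?thin_wake.
by apply: locally_harmonic_add_vanish => //; exact: thin_wake.
Qed.

End Vanishing.

(** [d y] is the probability of being killed before leaving [G]. A walk killed inside [G] never hits
    a site [x] outside, so [d + h <= 1]; the minimum principle on [G] proves it. *)
Lemma staying_probability nu (G : {set V}) : prob_distribution nu ->
  exists d : V -> R,
  [/\ forall y, y \in G -> d y = \sum_z K y z * d z + killing_rate K y,
      forall y, y \notin G -> d y = 0,
      G = [set: V]%SET -> \sum_y nu y * d y = 1,
      0 <= \sum_y nu y * d y
    & forall x, x \notin G ->
        \sum_y nu y * d y <= 1 - hitting_probability K nu x].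
Proof.
move=> [nu0 nu1].
have [d [dG dnG]] := dirichlet_exists Ksub Knd G
  (fun y => if y \in G then killing_rate K y else 0).
have {}dG y : y \in G -> d y = \sum_z K y z * d z + killing_rate K y.
  by move=> yG; rewrite dG// yG.
have {}dnG y : y \notin G -> d y = 0 by move=> yG; rewrite dnG// (negPf yG).
have killE y : \sum_z K y z + killing_rate K y = 1.
  by rewrite /killing_rate addrC subrK.
exists d; split=> //.
- move=> GT; rewrite -[RHS]nu1; apply: eq_bigr => y _.
  suff -> : d y = 1 by rewrite mulr1.
  move: y; apply: (dirichlet_unique Ksub Knd (G := G)
    (w' := fun=> 1) (b := killing_rate K)) => // y yG.
    by under eq_bigr do rewrite mulr1; rewrite killE.
  by move: yG; rewrite GT finset.in_setT.
- apply: sumr_ge0 => y _; rewrite mulr_ge0//; move: y.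
  apply: (restricted_superharmonic_ge0 Ksub Knd (G := G)) => y yG.
    by rewrite [leRHS]dG// lerDl killing_rate_ge0.
  by rewrite dnG.
move=> x xG; have [h [hx hK h01]] := hitting_function_exists Ksub Knd x.
rewrite (hitting_probabilityE Ksub Knd nu hx hK h01) -nu1 -sumrB.
apply: ler_sum => y _; rewrite -[X in _ <= X - _]mulr1 -mulrBr ler_wpM2l//.
rewrite -subr_ge0; move: y.
apply: (restricted_superharmonic_ge0 Ksub Knd (G := G)
  (w := fun y => 1 - h y - d y)) => y yG; last first.
  by rewrite dnG// subr0 subr_ge0; have /andP[] := h01 y.
have yx : y != x by apply: contraNneq xG => <-.
have -> : \sum_z K y z * (1 - h z - d z) =
    \sum_z K y z - \sum_z K y z * h z - \sum_z K y z * d z.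
  by under eq_bigr do rewrite !mulrBr mulr1; rewrite !sumrB.
by rewrite -hK// [d y]dG//; have := killE y; lra.
Qed.

(** * Filled configurations, the source of the left eigenvectors *)

Definition full_config (A : {set V}) : config V :=
  [ffun x => Some (x \in A : nat)].

Lemma active_full_config A x : active (full_config A) x = (x \in A).
Proof. by rewrite /active /active_particles ffunE; case: (x \in A). Qed.

(** The walk of the added particle ends only by killing, which restores the configuration; a
    constant solves the same equation. *)
Lemma locally_harmonic_add_full f y : locally_harmonic K lambda f ->
  f (add_particle (full_config [set: V]) y) = f (full_config [set: V]).
Proof.
move=> fH; set e := full_config _; move: y.
apply: (dirichlet_unique Ksub Knd (G := [set: V]%SET)
  (w := fun y => f (add_particle e y)) (w' := fun=> f e)
  (b := fun y => killing_rate K y * f e)) => y.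
- move=> _; apply: locally_harmonic_add_active => //.
  by rewrite active_full_config.
- by move=> _; rewrite -mulr_suml -mulrDl addrC subrK mul1r.
by rewrite finset.in_setT.
Qed.

Lemma add_particle_full_config x :
  add_particle (full_config [set~ x]) x = full_config [set: V].
Proof.
apply/ffunP => y; rewrite !ffunE !inE; case: eqVneq => //= _.
by rewrite eqxx.
Qed.

(** The added particle reaches the hole [x] with probability [h y] and fills it; otherwise it is
    killed. *)
Lemma locally_harmonic_add_almost_full f x y (h : V -> R) :
  locally_harmonic K lambda f -> h x = 1 ->
  (forall y, y != x -> h y = \sum_z K y z * h z) ->
  f (add_particle (full_config [set~ x]) y) =
    h y * (f (full_config [set: V]) - f (full_config [set~ x])) +
    f (full_config [set~ x]).
Proof.
move=> fH hx hK; set e := full_config [set~ x]; set e1 := full_config _.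
move: y; apply: (dirichlet_unique Ksub Knd (G := [set~ x]%SET)
  (w := fun y => f (add_particle e y)) (w' := fun y => h y * (f e1 - f e) + f e)
  (b := fun y => killing_rate K y * f e)) => y yx.
- by apply: locally_harmonic_add_active; rewrite // active_full_config.
- rewrite {1}hK; last by move: yx; rewrite !inE.
  under [in RHS]eq_bigr do rewrite mulrDr mulrA.
  rewrite big_split -!mulr_suml /= -addrA -mulrDl.
  by rewrite [X in _ + X * _]addrC subrK mul1r.
move: yx; rewrite !inE negbK => /eqP ->.
by rewrite add_particle_full_config hx mul1r subrK.
Qed.

(** Each active particle is alone, so with positive probability they fall asleep one after
    another. *)
Lemma stabilization_full_gt0 eta : thin eta ->
  (forall x, eta x != Some 0%N) -> 0 < stabilization K lambda [set: V] eta.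
Proof.
have [m] := ubnP #|active_sites eta|; elim: m eta => // m IH eta lem th ne0.
have [st|] := boolP (stable eta).
  rewrite stabilization_stable// (_ : _ == _) ?ltr01//.
  have [A eA] := stable_configP st; rewrite eA (inj_eq stable_config_inj).
  apply/eqP/finset.setP => x; rewrite finset.in_setT.
  by have := ne0 x; rewrite eA ffunE; case: ifP.
rewrite /stable negbK => /existsP[x act].
have ex : eta x = Some 1%N.
  move: act (forallP th x); rewrite /active /active_particles.
  by case: (eta x) => [[|[|k]]|].
rewrite (stabilization_locally_harmonic Ksub lambda_gt0 _ act) /topple.
have nn i : 0 <= instruction_weight K lambda x i *
    stabilization K lambda [set: V] (execute eta x i).
  by rewrite mulr_ge0 ?instruction_weight_ge0 ?stabilization_ge0.
rewrite (bigD1 (inr false : instruction))//= ltr_wpDr ?sumr_ge0//.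
rewrite mulr_gt0 ?divr_gt0 ?addr_gt0// /execute /= update_site_sleepE ex eqxx.
have slpE : active_sites (fall_asleep eta x) = (active_sites eta :\ x)%SET.
  apply/finset.setP => y; rewrite !inE /active /active_particles ffunE.
  by case: eqP.
apply: IH.
- rewrite slpE; move: lem; rewrite (cardsD1 x) inE act add1n ltnS; exact.
- apply/forallP => y; have := forallP th y.
  by rewrite /active_particles ffunE; case: eqP.
- by move=> y; rewrite ffunE; case: (y == x) => //; exact: ne0.
Qed.

(** Topplings never create particles, and the fully occupied state has [#|V|] of them. *)
Lemma stabilization_full_eq0 eta :
  particle_weight (fun=> 1) eta < #|V|%:R :> R ->
  stabilization K lambda [set: V] eta = 0.
Proof.
move=> lt; apply: cvg_lim => //; apply: cvg_near_cst; apply: nearW => n.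
have ne e : particle_weight (fun=> 1) e < #|V|%:R :> R ->
    (e == stable_config [set: V]) = false.
  move=> lte; apply/negbTE; apply: contraTneq lte => ->; rewrite -leNgt.
  rewrite /particle_weight -sum1_card natr_sum ler_sum// => x _.
  by rewrite ffunE finset.in_setT mulr1.
elim: n eta lt => [|n IH] eta lt /=; case: pickP => [x act|_]; rewrite ?ne//.
rewrite /topple big1// => i _; rewrite IH ?mulr0//.
exact: le_lt_trans (particles_execute _ act) lt.
Qed.

Lemma particle_weight_full_config (x : V) :
  particle_weight (fun=> 1) (full_config [set~ x]) < #|V|%:R :> R.
Proof.
rewrite /particle_weight -sum1_card natr_sum (bigD1 x)//= [ltRHS](bigD1 x)//=.
rewrite ffunE !inE eqxx mul0r ltr_leD// ler_sum// => y _.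
by rewrite ffunE mulr1 ler_nat /=; case: (_ \in _).
Qed.

(** * The eigenvalues of the transition matrix *)

Context (nu : V -> R).
Hypothesis nuP : prob_distribution nu.

Let P := arw_matrix K lambda nu.

Lemma eigenvalue_hitting x :
  eigenvalue P (1 - hitting_probability K nu x).
Proof.
have [h [hx hK h01]] := hitting_function_exists Ksub Knd x.
have [nu0 nu1] := nuP.
set p := hitting_probability K nu x.
have pE : p = \sum_y nu y * h y by exact: hitting_probabilityE.
pose S := stabilization K lambda.
pose c1 := full_config [set: V]; pose c := full_config [set~ x].
(* The row vector [mu(V \ {x}) - mu(V)]. *)
apply/eigenvalueP; exists (\row_j (S (enum_val j) c - S (enum_val j) c1)).
  apply/rowP => j; rewrite !mxE.
  have SH : locally_harmonic K lambda (S (enum_val j)).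
    exact: stabilization_locally_harmonic.
  under eq_bigr do rewrite !mxE mulrBl.
  rewrite sumrB.
  rewrite (sum_enum_val (fun A => S A c * arw_transition K lambda nu A _)).
  rewrite (sum_enum_val (fun A => S A c1 * arw_transition K lambda nu A _)).
  rewrite -!arw_intertwining// -/S.
  under eq_bigr do
    rewrite (locally_harmonic_add_almost_full _ SH hx hK) mulrDr mulrA.
  under [X in _ - X]eq_bigr do rewrite (locally_harmonic_add_full _ SH).
  rewrite big_split -!mulr_suml /= -pE nu1 -/c -/c1; ring.
(* Its entry at the full state is not zero: [c] has too few particles to reach that state, while
   [c1] reaches it with positive probability. *)
apply/eqP => /rowP/(_ (enum_rank [set: V]%SET)); rewrite !mxE enum_rankK.
apply/eqP; rewrite /S stabilization_full_eq0; last first.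
  exact: particle_weight_full_config.
rewrite sub0r oppr_eq0 gt_eqF// stabilization_full_gt0//.
  by apply/forallP => y; rewrite /active_particles ffunE; case: (_ \in _).
by move=> y; rewrite ffunE finset.in_setT.
Qed.

Lemma eigenvalue_bound (z : R[i]) :
  eigenvalue (map_mx (real_complex R) P) z -> z != 1 ->
  exists x q, [/\ z = q%:C%C, 0 <= q & q <= 1 - hitting_probability K nu x].
Proof.
move=> /right_eigenvector[v vE v0] z1.
pose u A := v (enum_rank A) 0.
have uE A : \sum_B (arw_transition K lambda nu A B)%:C%C * u B = z * u A.
  move/matrixP/(_ (enum_rank A) 0): vE; rewrite !mxE => <-.
  rewrite (reindex_onto (@enum_rank _) (@enum_val _ _)) => [|B _];
    last by rewrite enum_valK.
  apply: eq_big => [B|B _]; first by rewrite enum_rankK eqxx.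
  by rewrite !mxE !enum_rankK.
pose S := stabilization K lambda.
(* The extension of the eigenvector to all configurations, split into real and imaginary parts to
   use the real theory. *)
pose hR eta := \sum_B complex.Re (u B) * S B eta.
pose hI eta := \sum_B complex.Im (u B) * S B eta.
have hRH : locally_harmonic K lambda hR.
  by apply: locally_harmonic_sum => B; exact: stabilization_locally_harmonic.
have hIH : locally_harmonic K lambda hI.
  by apply: locally_harmonic_sum => B; exact: stabilization_locally_harmonic.
(* By the intertwining, adding a particle acts on an extension as the transition matrix acts on its
   values at stable states. *)
have step (w : {set V} -> R) eta :
    \sum_y nu y * (\sum_B w B * S B (add_particle eta y)) =
    \sum_A S A eta * \sum_B arw_transition K lambda nu A B * w B.
  under eq_bigr do rewrite mulr_sumr.
  rewrite exchange_big /=; under [RHS]eq_bigr do rewrite mulr_sumr.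
  rewrite [RHS]exchange_big; apply: eq_bigr => B _ /=.
  under eq_bigr do rewrite mulrCA.
  rewrite -mulr_sumr arw_intertwining// mulr_sumr; apply: eq_bigr => A _.
  by rewrite /S; ring.
have uRI A := congr1 (fun c => (complex.Re c, complex.Im c)) (uE A).
have hRstep eta : \sum_y nu y * hR (add_particle eta y) =
    complex.Re z * hR eta - complex.Im z * hI eta.
  rewrite step !mulr_sumr -sumrB; apply: eq_bigr => A _.
  move: (uRI A); rewrite complex_lincomb => -[-> _].
  by case: (z) => a b; case: (u A) => a' b' /=; ring.
have hIstep eta : \sum_y nu y * hI (add_particle eta y) =
    complex.Re z * hI eta + complex.Im z * hR eta.
  rewrite step !mulr_sumr -big_split; apply: eq_bigr => A _.
  move: (uRI A); rewrite complex_lincomb => -[_ ->].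
  by case: (z) => a b; case: (u A) => a' b' /=; ring.
pose nz eta := ((hR eta +i* hI eta)%C != 0).
(* A maximal [n] gives a thin configuration where the extension is not zero while it vanishes at all
   thin ones with more active sites. *)
pose Q n := `[< exists eta, [/\ thin eta, #|active_sites eta| = n & nz eta] >].
have exQ : exists n, Q n.
  have /existsP[A uA0] : [exists A, u A != 0].
    apply: contraNT v0 => /existsPn u0; apply/eqP/colP => i; rewrite mxE.
    by move: (u0 (enum_val i)); rewrite negbK /u enum_valK => /eqP.
  exists #|active_sites (stable_config A)|; apply/asboolP.
  exists (stable_config A); split=> //.
    apply/forallP => x; rewrite /active_particles ffunE.
    by case: ifP.
  have hA (w : {set V} -> R) : \sum_B w B * S B (stable_config A) = w A.
    rewrite (bigD1 A)//= big1 => [|B BA].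
      rewrite /S stabilization_stable ?stable_stable_config// eqxx.
      by rewrite mulr1 addr0.
    rewrite /S stabilization_stable ?stable_stable_config//.
    by rewrite (inj_eq stable_config_inj) eq_sym (negPf BA) mulr0.
  by rewrite /nz /hR /hI !hA; case: (u A) uA0.
have boundQ n : Q n -> (n <= #|V|)%N.
  by move=> /asboolP[eta [_ <- _]]; exact: max_card.
case: (ex_maxnP exQ boundQ) => n /asboolP[eta [th cardn nzeta]] maxn.
have h0 e : thin e -> (n < #|active_sites e|)%N -> hR e = 0 /\ hI e = 0.
  move=> the lt; have [nze|] := boolP (nz e); last first.
    by rewrite /nz negbK eq_complex /= => /andP[/eqP -> /eqP ->].
  have : Q #|active_sites e| by apply/asboolP; exists e.
  by move=> /maxn; rewrite leqNgt lt.
have [d [dG dnG dT d_ge0 d_le]] := staying_probability (active_sites eta) nuP.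
set q := \sum_y nu y * d y in dT d_ge0 d_le.
have addE f : locally_harmonic K lambda f ->
    (forall e, thin e -> (n < #|active_sites e|)%N -> f e = 0) ->
    \sum_y nu y * f (add_particle eta y) = q * f eta.
  move=> fH f0; rewrite mulr_suml; apply: eq_bigr => y _; rewrite -mulrA.
  congr (_ * _); apply: (locally_harmonic_add_maximal fH f0) => // {}y act.
    by apply: dG; rewrite inE.
  by apply: dnG; rewrite inE.
have addR := addE _ hRH (fun e th lt => (h0 e th lt).1).
have addI := addE _ hIH (fun e th lt => (h0 e th lt).2).
have zq : z = q%:C%C.
  (* At [eta], adding a particle multiplies the non-zero extension by both [z] and [q]. *)
  apply/eqP; rewrite -subr_eq0.
  have : (z - q%:C%C) * (hR eta +i* hI eta)%C == 0.
    move: (hRstep eta) (hIstep eta); rewrite addR addI.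
    case: (z) => a b /= E1 E2; rewrite eq_complex /=.
    by apply/andP; split; apply/eqP; [move: E1|move: E2] => E; lra.
  by rewrite mulf_eq0 (negPf nzeta) orbF.
(* If all sites were active, [q] and hence [z] would be 1. *)
have /existsP[x xG] : [exists x, x \notin active_sites eta].
  apply: contraNT z1 => /existsPn allG; rewrite zq dT//.
  apply/finset.setP => x; rewrite finset.in_setT.
  by have := allG x; rewrite negbK.
by exists x, q; split=> //; exact: d_le.
Qed.

End Spectrum.

(* The minimum may be started from 1, as hitting probabilities are at most 1. *)
Theorem theorem1 (R : realType) (V : finType) (K : V -> V -> R) (lambda : R)
    (nu : V -> R)
    (hV : (0 < #|V|)%N)
    (hK : substochastic K) (hKnd : non_degenerate K)
    (hlambda : 0 < lambda)
    (hnu : prob_distribution nu) (hadm : admissible K nu) :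
  is_relaxation_time (arw_matrix K lambda nu)
    (\big[Num.min/1]_(x : V) hitting_probability K nu x)^-1.
Proof.
set p := hitting_probability K nu.
have [x0 _] := card_gt0P hV.
have [x _ xmin] : {x : V | x \in predT & \big[Num.min/1]_x p x = p x}.
  by apply: (eq_bigmin x0) => // y _; exact: hitting_probability_le1.
have p_min y : p x <= p y by rewrite -xmin; exact: bigmin_le.
have p_gt0 : 0 < p x by exact: hitting_probability_gt0.
have p_le1 : p x <= 1 by exact: hitting_probability_le1.
rewrite xmin; exists (1 - p x); split; last by rewrite subKr div1r.
- exists (1 - p x)%:C%C; split.
  + by rewrite eigenvalue_map; exact: eigenvalue_hitting.
  + rewrite eq_complex /= eqxx andbT; apply/eqP => E.
    by move: p_gt0; rewrite -(subKr 1 (p x)) E subrr ltxx.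
  + by rewrite ger0_norm// lecR subr_ge0.
move=> r [z [zP z1 zr]].
have [y [q [zq q0 qp]]] := eigenvalue_bound hK hKnd hlambda hnu zP z1.
have : `|z| = q%:C%C by rewrite zq ger0_norm// lecR.
rewrite zr => -[->]; apply: le_trans qp _.
by rewrite lerD2l lerN2.
Qed.
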